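(* Let $r\ge 2$. For all $n,k\ge0$, the $(n,k)$ entry of the matrix $Q_{\rm C}^{(r)}=\check{C}^{(r)}B^{-1}$ of $r$th-order quasi-Eulerian cycle numbers equals $|\mathfrak{S}_{n,k}^{(r)}|$, the number of Stirling permutations of the multiset $M_n^{(r)}$ with exactly $k$ consecutive ascents. Also, for $0\le k\le n$, the $r$th-order Stirling cycle number $\left[{n\atop k}\right]^{(r)}$ is the number of consecutive-ascent-marked Stirling permutations of order $r$ and size $n$ with $n-k$ dots, i.e. $\left[{n\atop k}\right]^{(r)}=|\mathcal{V}_{n,n-k}^{(r)}|$.
   Context: The $r$th-order Stirling cycle number $\left[{n\atop k}\right]^{(r)}$ ($n,k\ge 0$) is the number of permutations of $[n+(r-1)k]$ with exactly $k$ cycles, all of size $\ge r$. $\check{C}^{(r)}$ is the infinite lower-triangular matrix with $(n,k)$ entry $\left[{n\atop n-k}\right]^{(r)}$ for $0\le k\le n$ and $0$ for $k>n$. $B=\big(\binom{n}{k}\big)_{n,k\ge0}$ is the binomial matrix. $M_n^{(r)}$ is the multiset on the letters $1,2,\ldots,(r-1)n$ in which the letter $i$ has multiplicity $2$ if $i\equiv 0 \pmod{r-1}$ and multiplicity $1$ otherwise. A Stirling permutation of $M_n^{(r)}$ is a word that is a permutation of this multiset such that for every letter $a$ all letters between two successive occurrences of $a$ are larger than $a$. $\mathfrak{S}_n^{(r)}$ is the set of Stirling permutations of $M_n^{(r)}$. For $\sigma\in\mathfrak{S}_n^{(r)}$, an element $i\in[n]$ is a consecutive ascent of $\sigma$ if,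 writing $a_j=(r-1)(i-1)+j$ for $1\le j\le r-1$, the letters $a_1,a_2,\ldots,a_{r-2}$ and the first occurrence of $a_{r-1}=(r-1)i$ occur consecutively, in this order, in $\sigma$ (for $r=2$ this is just the first occurrence of the letter $i$), and this string is immediately preceded in $\sigma$ by a letter smaller than $a_1$. $\mathrm{CAsc}(\sigma)\subseteq[n]$ is the set of consecutive ascents of $\sigma$, and $\mathfrak{S}_{n,k}^{(r)}=\{\sigma\in\mathfrak{S}_n^{(r)}: |\mathrm{CAsc}(\sigma)|=k\}$. A consecutive-ascent-marked Stirling permutation of order $r$ and size $n$ with $k$ dots is a pair $(\sigma,D)$ with $\sigma\in\mathfrak{S}_n^{(r)}$, $D\subseteq\mathrm{CAsc}(\sigma)$ and $|D|=k$; $\mathcal{V}_{n,k}^{(r)}$ is the set of these. *)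

(* Defs.v *)
From mathcomp Require Import all_boot all_order all_algebra all_fingroup.
From mathcomp Require Import finmap ring.

Set Implicit Arguments.
Unset Strict Implicit.
Unset Printing Implicit Defensive.

Import Order.TTheory GRing.Theory Num.Theory.

Local Open Scope fset_scope.
Local Open Scope nat_scope.

Definition infmx := nat -> nat -> int.

Definition lower_triangular (A : infmx) := forall n k, n < k -> A n k = 0%R.

Definition infmx1 : infmx := fun n k => ((n == k)%:R)%R.

(* Row n of a lower-triangular A is supported on the columns j <= n, so this
   finite sum is the whole row-by-column product. *)
Definition ltmul (A B : infmx) : infmx :=
  fun n k => (\sum_(j < n.+1) A n j * B j k)%R.

Definition trunc N (A : infmx) : 'M[int]_N := (\matrix_(i < N, j < N) A i j)%R.

(* The inverse of a lower-triangular matrix, read off its leading principal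
   submatrices. It is the two-sided inverse whenever A has a lower-triangular
   one (ltinv_unique, ltmul1C), as binmx does (binmx_mulV). *)
Definition ltinv (A : infmx) : infmx :=
  fun n k => let N := maxn n k in invmx (trunc N.+1 A) (inord n) (inord k).

Definition binmx : infmx := fun n k => (('C(n, k))%:R)%R.

(* porbits s is the set of cycles of s, fixed points included. *)
Definition stirling_cycle (r n k : nat) : nat :=
  #|[set s : 'S_(n + r.-1 * k) |
      (#|porbits s| == k) && [forall c in porbits s, r <= #|c|]]|.

Definition checkC (r : nat) : infmx :=
  fun n k => if k <= n then Posz (stirling_cycle r n (n - k)) else 0%R.

Definition quasi_eulerian_cycle (r : nat) : infmx :=
  ltmul (checkC r) (ltinv binmx).

Definition Mseq (r n : nat) : seq nat :=
  flatten [seq nseq (if r.-1 %| i then 2 else 1) i | i <- iota 1 (r.-1 * n)].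

(* The factor of s strictly between positions i and j (for i < j). *)
Definition between (s : seq nat) (i j : nat) : seq nat :=
  take (j - i.+1) (drop i.+1 s).

Definition stirling_word (s : seq nat) : bool :=
  [forall i : 'I_(size s), forall j : 'I_(size s),
     [&& i < j, nth 0 s i == nth 0 s j & nth 0 s i \notin between s i j] ==>
     all (fun b => nth 0 s i < b) (between s i j)].

Definition stirling_perms (r n : nat) : {fset seq nat} :=
  [fset s in permutations (Mseq r n) | stirling_word s].

(* The letters a_1, ..., a_(r-1) attached to i, with a_j = (r-1)(i-1) + j. *)
Definition block (r i : nat) : seq nat := iota (r.-1 * i.-1 + 1) r.-1.

(* p is the position of a_1. The string must have a letter on its left: a
   string at the beginning of the word is not a consecutive ascent. *)
Definition consec_asc (r : nat) (s : seq nat) (i : nat) : bool :=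
  [exists p : 'I_(size s),
     [&& prefix (block r i) (drop p s),
         index (r.-1 * i) s == p + (r - 2),
         0 < p
       & nth 0 s p.-1 < r.-1 * i.-1 + 1]].

Definition CAsc (r n : nat) (s : seq nat) : {fset nat} :=
  [fset i in iota 1 n | consec_asc r s i].

Definition stirling_perms_casc (r n k : nat) : {fset seq nat} :=
  [fset s in stirling_perms r n | #|` CAsc r n s| == k].

Definition marked_stirling_perms (r n k : nat) :
    {fset (seq nat * {fset nat})} :=
  [fset p in stirling_perms r n `*` fpowerset [fset i in iota 1 n] |
     (p.2 `<=` CAsc r n p.1) && (#|` p.2| == k)].

Lemma in_stirling_perms r n s :
  (s \in stirling_perms r n) = perm_eq s (Mseq r n) && stirling_word s.
Proof. by rewrite !inE /= mem_permutations. Qed.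

Lemma in_marked_stirling_perms r n k s D :
  ((s, D) \in marked_stirling_perms r n k) =
  [&& s \in stirling_perms r n, D `<=` CAsc r n s & #|` D| == k].
Proof.
apply/idP/and3P => [|[sS DC Dk]].
  by rewrite 2!inE /= in_fsetM => /andP[/andP[sS _] /andP[]]; split.
rewrite 2!inE /= DC Dk in_fsetM !andbT sS /= fpowersetE.
apply: (fsubset_trans DC).
by apply/fsubsetP => i; rewrite !inE => /andP[].
Qed.

Lemma trunc_ltmul N A B : lower_triangular A ->
  trunc N (ltmul A B) = (trunc N A *m trunc N B)%R.
Proof.
move=> ltA; apply/matrixP => i j; rewrite !mxE /ltmul.
rewrite [RHS](eq_bigr (fun k : 'I_N => A i k * B k j)%R); last first.
  by move=> k _; rewrite !mxE.
rewrite (big_ord_widen N (fun k => A i k * B k j)%R (ltn_ord i)) big_mkcond.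
apply: eq_bigr => k _; rewrite ltnS; case: leqP => // ik.
by rewrite ltA // mul0r.
Qed.

Lemma ltinv_unique A A' : lower_triangular A ->
  (forall n k, ltmul A A' n k = infmx1 n k) ->
  forall n k, ltinv A n k = A' n k.
Proof.
move=> ltA AA' n k; rewrite /ltinv; set N := maxn n k.
have AA1 : (trunc N.+1 A *m trunc N.+1 A' = 1%:M)%R.
  by rewrite -trunc_ltmul //; apply/matrixP => i j; rewrite !mxE AA'.
have [uA _] := mulmx1_unit AA1.
have -> : invmx (trunc N.+1 A) = trunc N.+1 A'.
  by rewrite -[LHS]mulmx1 -AA1 mulKmx.
by rewrite mxE !inordK // ltnS ?leq_maxl ?leq_maxr.
Qed.

Lemma ltmul1C A A' : lower_triangular A -> lower_triangular A' ->
  (forall n k, ltmul A A' n k = infmx1 n k) ->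
  forall n k, ltmul A' A n k = infmx1 n k.
Proof.
move=> ltA ltA' AA' n k; set N := maxn n k.
have nN : n < N.+1 by rewrite ltnS leq_maxl.
have kN : k < N.+1 by rewrite ltnS leq_maxr.
have AA1 : (trunc N.+1 A *m trunc N.+1 A' = 1%:M)%R.
  by rewrite -trunc_ltmul //; apply/matrixP => i j; rewrite !mxE AA'.
have /matrixP/(_ (Ordinal nN) (Ordinal kN)) := mulmx1C AA1.
by rewrite -trunc_ltmul // !mxE.
Qed.

Definition binmxV : infmx := fun n k => ((-1) ^+ (n + k) * ('C(n, k))%:R)%R.

Lemma binmx_lt : lower_triangular binmx.
Proof. by move=> n k nk; rewrite /binmx bin_small. Qed.

Lemma binmxV_lt : lower_triangular binmxV.
Proof. by move=> n k nk; rewrite /binmxV bin_small // mulr0. Qed.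

Lemma coef_subX1_exp j k : ((('X - 1) ^+ j : {poly int})`_k = binmxV j k)%R.
Proof.
elim: j k => [|j IHj] [|k]; rewrite ?expr0 ?coef1 /binmxV ?bin0 ?mul1r //=.
- by rewrite mulr0.
- rewrite exprSr mulrBr mulr1 coefB coefMX /= IHj /binmxV !bin0 !addn0.
  by rewrite exprS; ring.
- rewrite exprSr mulrBr mulr1 coefB coefMX /= !IHj /binmxV binS natrD.
  by rewrite !addSn !addnS !exprS; ring.
Qed.

Lemma binmx_mulV n k : ltmul binmx binmxV n k = infmx1 n k.
Proof.
have E : ('X^n = \sum_(j < n.+1) ('X - 1) ^+ j *+ 'C(n, j) :> {poly int})%R.
  rewrite -{1}[('X)%R](subrK 1%R) addrC exprDn.
  by apply: eq_bigr => j _; rewrite expr1n mul1r.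
have := congr1 (fun p : {poly int} => p`_k)%R E.
rewrite coefXn coef_sum /infmx1 eq_sym => ->.
apply: eq_bigr => j _.
by rewrite coefMn coef_subX1_exp /binmx mulr_natl.
Qed.

Lemma binmx_ltinv n k :
  ltinv binmx n k = ((-1) ^+ (n + k) * ('C(n, k))%:R)%R.
Proof. exact: (ltinv_unique binmx_lt binmx_mulV). Qed.

(* Main.v *)
(* Both sides of the second identity satisfy
     c(n+1, k+1) = (n + (r-1)(k+1)) c(n, k+1) + (n + (r-1)(k+1))^_(r-1) c(n, k).
   For permutations of N points, single out a point x. If its cycle has more
   than r elements, delete x; the point next to x can be restored in N - 1 ways.
   If its cycle has exactly r elements, deleting these one after the other gives
   the falling factorial.
   For marked Stirling permutations, remove the letters of the last block. If
   the block is marked, it was inserted as a whole; otherwise its letters were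
   inserted one by one, the two copies of the last one together since nothing
   larger can separate them. A dot forbids exactly r - 1 gaps, namely those in
   front of the letters of its string, and these gaps are distinct for distinct
   dots, so the number of choices depends only on the number of dots.
   The first identity follows: summing over the sets of dots gives
   V(n, j) = sum_l S(n, l) C(l, j), that is, checkC = S B. *)

Require Import Defs.
From mathcomp Require Import all_boot all_order all_algebra all_fingroup.
From mathcomp Require Import finmap.
From mathcomp Require Import zify.

Set Implicit Arguments.
Unset Strict Implicit.
Unset Printing Implicit Defensive.

Import GRing.Theory.

Local Open Scope nat_scope.

(** * Permutations with long cycles *)

(** The recurrence common to both sides. At [n'.+1], [k'.+1] the ground set has [n' + r.-1 * k + 1]
    points, so the coefficients count choices among the points other than a distinguished one. *)
Fixpoint cycle_rec (r n k : nat) : nat :=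
  match n, k with
  | 0, 0 => 1
  | 0, _.+1 | _.+1, 0 => 0
  | n'.+1, k'.+1 => (n' + r.-1 * k) * cycle_rec r n' k +
                    (n' + r.-1 * k) ^_ r.-1 * cycle_rec r n' k'
  end.

(** * Insertion of a fixed point into a cycle *)

Section PermInsert.

Variable T : finType.
Implicit Types (s u : {perm T}) (x y z : T) (A : {set T}).

Lemma porbit_sub s z A :
  z \in A -> {in A, forall w, s w \in A} -> porbit s z \subset A.
Proof.
move=> zA sA; apply/subsetP => w /porbitP [i ->].
by elim: i => [|i IHi]; rewrite ?expg0 ?perm1 // expgSr permM sA.
Qed.

Lemma porbit_step s z w : w \in porbit s z -> s w \in porbit s z.
Proof. by rewrite -!eq_porbit_mem -(porbit_perm s 1 w) expg1. Qed.

Lemma eq_in_porbit s u z :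
  {in porbit u z, s =1 u} -> porbit s z = porbit u z.
Proof.
move=> su; have E i : (s ^+ i)%g z = (u ^+ i)%g z.
  elim: i => [|i IHi]; rewrite ?expg0 // !expgSr !permM IHi su //.
  exact: mem_porbit.
by apply/setP => w; apply/porbitP/porbitP => [] [i ->]; exists i; rewrite E.
Qed.

Lemma porbit_fix s x : s x = x -> porbit s x = [set x].
Proof.
move=> sx; apply/eqP; rewrite eqEsubset sub1set porbit_id andbT.
by apply: porbit_sub => [|w]; rewrite ?inE // => /eqP ->; rewrite sx.
Qed.

Lemma porbit_avoid u x z : u x = x -> z != x -> x \notin porbit u z.
Proof. by move=> ux zx; rewrite porbit_sym porbit_fix // inE. Qed.

Section Ins.
Variables (u : {perm T}) (x y : T).
Hypotheses (ux : u x = x) (yx : y != x).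
(** Products act from left to right: [s] sends [x] to [y] and the [u]-preimage of [y] to [x]. So the
    fixed point [x] is inserted just before [y] in the cycle of [y]. *)
Let s := (u * tperm x y)%g.

Lemma porbit_insx : porbit s x = x |: porbit u y.
Proof.
have sx : s x = y by rewrite permM ux tpermL.
apply/eqP; rewrite eqEsubset; apply/andP; split.
  apply: porbit_sub => [|w]; first by rewrite setU11.
  rewrite !inE => /predU1P [->|wy]; first by rewrite sx porbit_id orbT.
  rewrite permM; case: tpermP => [||_ _]; rewrite ?eqxx ?porbit_id ?orbT //.
  by rewrite porbit_step ?orbT.
rewrite subUset sub1set porbit_id /=; apply: porbit_sub.
  by rewrite -sx porbit_step ?porbit_id.
move=> w wx; have := porbit_step wx; rewrite permM.
case: tpermP => [-> _|-> _|//]; first exact: porbit_id.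
by rewrite -sx porbit_step ?porbit_id.
Qed.

Lemma porbit_ins z : z != x ->
  porbit s z = if y \in porbit u z then x |: porbit u z else porbit u z.
Proof.
move=> zx; have xz := porbit_avoid ux zx.
case: ifP => [|yz].
  rewrite -eq_porbit_mem => /eqP yz; rewrite -yz -porbit_insx; apply/eqP.
  by rewrite eq_porbit_mem porbit_insx inE yz porbit_id orbT.
apply: eq_in_porbit => w wz; rewrite permM tpermD //.
  by apply: contraNneq xz => ->; exact: porbit_step.
by apply: contraFneq yz => ->; exact: porbit_step.
Qed.

(** Insertion acts on orbits by [F], which adds [x] to the orbit of [y] and keeps the others. No
    orbit of [u] through a point of [A] contains [x], so removing [x] inverts [F]. *)
Lemma card_porbits_ins A : y \in A -> x \notin A ->
  #|porbit s @: (x |: A)| = #|porbit u @: A|.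
Proof.
move=> yA xA; pose F (C : {set T}) := if y \in C then x |: C else C.
have zx z : z \in A -> z != x by apply: contraTneq => ->.
have FE : {in A, forall z, porbit s z = F (porbit u z)}.
  by move=> z zA; rewrite /F porbit_ins ?zx.
have -> : porbit s @: (x |: A) = F @: (porbit u @: A).
  have /setUidPr xy : [set porbit s x] \subset porbit s @: A.
    rewrite sub1set; apply/imsetP; exists y => //.
    by rewrite (FE y yA) /F porbit_id porbit_insx.
  rewrite imsetU1 xy.
  by rewrite -imset_comp; apply: eq_in_imset => z /FE.
apply: card_in_imset => _ _ /imsetP [z zA ->] /imsetP [t tA ->].
have /setU1K Ez := porbit_avoid ux (zx _ zA).
have /setU1K Et := porbit_avoid ux (zx _ tA).
rewrite /F; case: ifP => yz; case: ifP => yt E //.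
- by rewrite -Ez -Et E.
- by have := porbit_avoid ux (zx _ tA); rewrite -E setU11.
- by have := porbit_avoid ux (zx _ zA); rewrite E setU11.
Qed.

End Ins.

(** * Counting permutations with long cycles by deleting points *)

Variable r : nat.

(** The support [A] varies inside a fixed type, so that a point is deleted by shrinking [A]. Points
    outside [A] are fixed, and their cycles are not counted. *)
Definition long_cycles A (k : nat) : {set {perm T}} :=
  [set s | [&& perm_on A s, #|porbit s @: A| == k
             & [forall z in A, r <= #|porbit s z|]]].

(* The size of the cycle of x obeys J instead of being at least r. *)
Definition pointed_cycles A x (J : pred nat) (k : nat) : {set {perm T}} :=
  [set s | [&& perm_on A s, #|porbit s @: A| == k,
               [forall z in A, (z \in porbit s x) || (r <= #|porbit s z|)]
             & J #|porbit s x|]].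

Lemma long_pointed A x k : x \in A ->
  long_cycles A k = pointed_cycles A x (leq r) k.
Proof.
move=> xA; apply/setP => s; rewrite !inE; congr [&& _, _ & _].
apply/forall_inP/andP => [sr | [/forall_inP sr rx] z zA].
  by split; [apply/forall_inP => z zA; rewrite sr ?orbT | exact: sr].
by case/orP: (sr z zA); rewrite // -eq_porbit_mem => /eqP ->.
Qed.

Lemma perm_on_ins A u x y : x \in A -> y \in A ->
  perm_on (A :\ x) u = perm_on A (u * tperm x y)%g && (u x == x).
Proof.
move=> xA yA; have tA : perm_on A (tperm x y).
  by apply/subsetP => z; rewrite inE; case: tpermP => [->|->|]; rewrite ?eqxx.
apply/idP/andP => [uA | [usA /eqP ux]].
  split; last by rewrite (out_perm uA) // !inE eqxx.
  by apply: perm_onM tA; apply: subset_trans uA (subsetDl _ _).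
have uA : perm_on A u by rewrite -[u](mulgK (tperm x y)) tpermV perm_onM.
apply/subsetP => z; rewrite !inE => uz; rewrite (contraNneq _ uz) => [|->].
  by move/subsetP: uA => -> //; rewrite inE.
by rewrite ux.
Qed.

(** Deleting [x] shortens its cycle by one, hence the shift of [J], and its image [y] becomes the
    distinguished point. The cycle being reduced is exempt from the bound [r], so it may become
    short. *)
Lemma pointed_ins A x y J k u : x \in A -> y \in A :\ x ->
  (u \in pointed_cycles (A :\ x) y (J \o succn) k) =
  ((u * tperm x y)%g \in pointed_cycles A x J k) && (u x == x).
Proof.
move=> xA; rewrite !inE => /andP [yx yA].
rewrite (perm_on_ins u xA yA) andbAC -!andbA [RHS]andbC -!andbA.
case uAs: perm_on; rewrite ?andbF //= andbC -!andbA.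
case: eqP; rewrite ?andbF // => ux.
have xA' : x \notin A :\ x by rewrite !inE eqxx.
have yA' : y \in A :\ x by rewrite !inE yx.
rewrite porbit_insx // cardsU1 porbit_avoid // add1n !andbT /=.
have E : #|porbit u @: (A :\ x)| = #|porbit (u * tperm x y)%g @: A|.
  by rewrite -(card_porbits_ins ux yA' xA') setD1K.
rewrite E andbA andbC; congr [&& _, _ & _].
apply/forall_inP/forall_inP => H z.
  have [-> _|zx zA] := eqVneq z x; first by rewrite !inE eqxx.
  have zA' : z \in A :\ x by rewrite !inE zx.
  have := H z zA'; rewrite !inE (negPf zx) /= porbit_ins // [y \in _]porbit_sym.
  by case: (z \in _).
rewrite !inE => /andP [zx zA].
have := H z zA; rewrite !inE (negPf zx) porbit_ins //= [y \in _]porbit_sym.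
by case: (z \in _).
Qed.

(** Classify [s] by [y = s x], where [~~ J 1] rules out [s x = x]. Right multiplication by
    [tperm x y] matches each class with permutations of the smaller set. *)
Lemma card_pointed_step A x J k : x \in A -> ~~ J 1 ->
  #|pointed_cycles A x J k| =
  \sum_(y in A :\ x) #|pointed_cycles (A :\ x) y (J \o succn) k|.
Proof.
move=> xA J1; rewrite -sum1_card.
rewrite (partition_big (fun s : {perm T} => s x) (mem (A :\ x))) /=; last first.
  move=> s; rewrite !inE => /and4P [sA _ _ Jx].
  rewrite (perm_closed _ sA) xA andbT; apply: contraNneq J1 => sx.
  by move: Jx; rewrite porbit_fix // cards1.
apply: eq_bigr => y yA.
rewrite sum1_card -[RHS](card_imset _ (mulIg (tperm x y))); apply: eq_card => s.
rewrite -[in LHS]topredE /=; apply/idP/imsetP => [/andP [sA /eqP sx] | [u]].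
  exists (s * tperm x y)%g; last by rewrite -{2}tpermV mulgK.
  rewrite pointed_ins // -{2}tpermV mulgK permM sx tpermR eqxx andbT.
  by move: sA; rewrite !inE.
rewrite pointed_ins // => /andP [uA /eqP ux] ->; move: uA; rewrite inE => -> /=.
by rewrite permM ux tpermL.
Qed.

Lemma perm_on_fix A u x : x \in A ->
  perm_on (A :\ x) u = perm_on A u && (u x == x).
Proof. by move=> xA; rewrite (perm_on_ins u xA xA) tperm1 mulg1. Qed.

Lemma pointed_fix A x k : x \in A ->
  pointed_cycles A x (pred1 1) k.+1 = long_cycles (A :\ x) k.
Proof.
move=> xA; apply/setP => s; rewrite !inE perm_on_fix //.
have -> : (#|porbit s x| == 1) = (s x == x).
  apply/idP/eqP => [/cards1P [z xz]|/porbit_fix ->]; last by rewrite cards1.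
  have := porbit_step (porbit_id s x); rewrite xz inE => /eqP ->.
  by have := porbit_id s x; rewrite xz inE => /eqP.
have [sx|_] := eqVneq (s x) x; rewrite ?andbF //= !andbT.
have [sA|//] := boolP (perm_on A s); rewrite /=.
have xs : [set x] \notin porbit s @: (A :\ x).
  apply/imsetP => -[z]; rewrite !inE => /andP [zx _] E.
  by have := porbit_id s z; rewrite -E inE (negPf zx).
rewrite -{1}(setD1K xA) imsetU1 porbit_fix // cardsU1 xs add1n eqSS; congr (_ && _).
apply/forall_inP/forall_inP => H z.
  by rewrite !inE => /andP [zx zA]; have := H z zA; rewrite inE (negPf zx).
by move=> zA; rewrite inE; case: eqVneq => //= zx; apply: H; rewrite !inE zx.
Qed.

Lemma pointed0 A x J : x \in A -> (pointed_cycles A x J 0) = set0.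
Proof.
move=> xA; apply/setP => s; rewrite !inE cards_eq0; apply/and4P => -[_ /eqP E].
by have := imset_f (porbit s) xA; rewrite E inE.
Qed.

(** The cycle is deleted point by point until only the distinguished point remains, the case counted
    by the hypothesis. The choices [m + j], ..., [m + 1] multiply to the falling factorial. *)
Lemma card_pointed_size j m v k : (forall A x, x \in A -> #|A| = m.+1 ->
    #|pointed_cycles A x (pred1 1) k| = v) ->
  forall A x, x \in A -> #|A| = (m + j).+1 ->
    #|pointed_cycles A x (pred1 j.+1) k| = (m + j) ^_ j * v.
Proof.
move=> H1; elim: j => [|j IHj] A x xA Am.
  by rewrite addn0 in Am *; rewrite mul1n H1.
have Ax : #|A :\ x| = (m + j).+1 by have := cardsD1 x A; rewrite xA Am; lia.
rewrite card_pointed_step // (eq_bigr (fun=> (m + j) ^_ j * v)) => [|y yA].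
  by rewrite sum_nat_const Ax addnS ffactSS mulnA.
exact: IHj.
Qed.

Lemma card_long_cycles n k A : 1 < r -> #|A| = n + r.-1 * k ->
  #|long_cycles A k| = cycle_rec r n k.
Proof.
move=> r1; elim: n k A => [|n IHn] [|k] A An.
- have /eqP A0 : A == set0 by rewrite -cards_eq0 An muln0.
  rewrite (_ : long_cycles A 0 = [set 1%g]) ?cards1 //; apply/setP => s.
  rewrite A0 !inE imset0 cards0 /=; apply/andP/eqP => [[s0 _]|->].
    by apply: perm_on_id s0 _; rewrite cards0.
  by rewrite perm_on1; split=> //; apply/forall_inP => z; rewrite inE.
- apply: eq_card0 => s; rewrite !inE; apply/and3P => -[sA /eqP sk /forall_inP sr].
  (* Cycles are disjoint, so [k.+1] long ones need [r * k.+1] points, while [A] has only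
     [r.-1 * k.+1]. *)
  suff : r * k.+1 <= #|A| by rewrite An; lia.
  have /card_partition -> : partition (porbit s @: A) A.
    apply/and3P; split.
    - rewrite eqEsubset; apply/andP; split; apply/subsetP => z.
        case/bigcupP => _ /imsetP [t tA ->]; apply/subsetP; apply: porbit_sub => //.
        by move=> w wA; rewrite (perm_closed _ sA).
      by move=> zA; apply/bigcupP; exists (porbit s z); rewrite ?imset_f ?porbit_id.
    - apply/trivIsetP => _ _ /imsetP [z zA ->] /imsetP [t tA ->] zt.
      rewrite -setI_eq0; apply: contraNT zt => /set0Pn [w].
      by rewrite inE -!eq_porbit_mem => /andP [/eqP <- /eqP <-].
    by apply/imsetP => -[z _ /setP /(_ z)]; rewrite porbit_id inE.
  rewrite mulnC -sk -sum_nat_const; apply: leq_sum => _ /imsetP [z zA ->].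
  exact: sr.
- have /card_gt0P [x xA] : 0 < #|A| by rewrite An.
  by rewrite (long_pointed _ xA) pointed0 ?cards0.
have /card_gt0P [x xA] : 0 < #|A| by rewrite An.
have cA (B : {set T}) y : y \in B -> #|B :\ y| = #|B|.-1.
  by move=> yB; rewrite (cardsD1 y B) yB.
have -> : #|long_cycles A k.+1| =
    #|pointed_cycles A x (leq r.+1) k.+1| + #|pointed_cycles A x (pred1 r) k.+1|.
  rewrite (long_pointed _ xA) addnC -cardsUI.
  rewrite [X in _ = _ + X](_ : _ = 0) ?addn0; last first.
    by apply: eq_card0 => s; rewrite !inE;
      case: (#|porbit s x| =P r) => [->|]; rewrite ?ltnn ?andbF.
  apply: eq_card => s; rewrite !inE -!andb_orr [r <= #|porbit s x|]leq_eqVlt.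
  by congr [&& _, _, _ & _]; rewrite eq_sym.
congr (_ + _).
  (* After one deletion the condition [leq r.+1] becomes [leq r], so ordinary long cycles remain. *)
  rewrite card_pointed_step //; last by lia.
  rewrite (eq_bigr (fun=> cycle_rec r n k.+1)) => [|y yA].
    by rewrite sum_nat_const cA // An.
  have Ax : #|A :\ x| = n + r.-1 * k.+1 by rewrite cA // An.
  by rewrite -(IHn _ _ Ax) (long_pointed _ yA); apply: eq_card.
(* Here [m] is [n + r.-1 * k] and [j] is [r.-1]; the fixed point left at the end is removed too,
   which leaves [m] points. *)
have -> : n + r.-1 * k.+1 = n + r.-1 * k + r.-1 by lia.
have r0 : r.-1.+1 = r by lia.
rewrite -{1}r0; apply: card_pointed_size => //; last by rewrite An; lia.
by move=> B y yB Bn; rewrite pointed_fix // IHn // cA // Bn.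
Qed.

End PermInsert.

Lemma stirling_cycleE r n k : 1 < r -> stirling_cycle r n k = cycle_rec r n k.
Proof.
move=> r1; rewrite -(@card_long_cycles 'I_(n + r.-1 * k) r n k setT) ?cardsT ?card_ord //.
apply: eq_card => s; rewrite !inE.
have -> : perm_on [set: 'I_(n + r.-1 * k)] s by apply/subsetP => z; rewrite inE.
have -> : porbit s @: [set: 'I_(n + r.-1 * k)] = porbits s.
  by apply/setP => c; apply/imsetP/imsetP => -[z _ ->]; exists z.
congr (_ && _); apply/forall_inP/forall_inP => H z; first by move=> _; apply/H/imset_f.
by case/imsetP => t _ ->; apply: H.
Qed.

(** * Stirling words *)

Implicit Types (s t u v w : seq nat) (a b c p : nat).

Lemma between_cat u a m b z :
  between (u ++ a :: m ++ b :: z) (size u) (size u + (size m).+1) = m.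
Proof.
rewrite /between -cat_rcons drop_size_cat ?size_rcons // addnS subSS addKn.
exact: take_size_cat.
Qed.

Lemma cat_between s i j : i < j < size s ->
  s = take i s ++ nth 0 s i :: between s i j ++ nth 0 s j :: drop j.+1 s.
Proof.
case/andP=> ij js; rewrite /between -drop_nth //.
rewrite -[in LHS](cat_take_drop i s) (drop_nth 0); last by lia.
congr (_ ++ _ :: _); rewrite -[LHS](cat_take_drop (j - i.+1)) drop_drop.
by congr (_ ++ drop _ _); lia.
Qed.

Lemma subseq_consP x l s :
  reflect (exists u v, s = u ++ x :: v /\ subseq l v) (subseq (x :: l) s).
Proof.
apply: (iffP idP) => [|[u [v [-> lv]]]]; last first.
  by rewrite -[x :: l]cat0s cat_subseq ?sub0seq //= eqxx.
elim: s => //= y s IHs; case: eqP => [<- ls | _ /IHs [u [v [-> lv]]]].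
  by exists [::], s.
by exists (y :: u), v.
Qed.

Lemma subseq_cons_catr a l u s :
  a \notin u -> subseq (a :: l) (u ++ s) -> subseq (a :: l) s.
Proof.
elim: u => //= x u IHu; rewrite inE negb_or => /andP [/negPf -> au].
exact: IHu.
Qed.

(* Avoiding the pattern 212 is better behaved under insertion and erasure of
   letters than the condition on successive occurrences. *)
Lemma stirling_wordP s :
  reflect (forall a b, subseq [:: a; b; a] s -> a <= b) (stirling_word s).
Proof.
apply: (iffP idP) => [/forallP sS a b | sS]; last first.
  apply/forallP => i; apply/forallP => j; apply/implyP => /and3P [ij /eqP eij].
  move=> ni; apply/allP => b bB.
  have ib : nth 0 s i != b by apply: contraNneq ni => ->.
  rewrite ltn_neqAle ib /=; apply: sS.
  have ijs : i < j < size s by rewrite ij /=.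
  apply/subseq_consP; exists (take i s); eexists.
  split; first exact: (cat_between ijs).
  rewrite -eij.
  rewrite (_ : [:: b; _] = [:: b] ++ [:: nth 0 s i]) // cat_subseq ?sub1seq //.
  by rewrite inE eqxx.
case/subseq_consP => u [v [Es /subseq_consP [m1 [m2 [Ev]]]]].
rewrite sub1seq => /splitPr am; case: am Ev => m3 z Ev.
have {Ev Es} : s = u ++ a :: (m1 ++ b :: m3) ++ a :: z by rewrite Es Ev -!catA.
have : b \in m1 ++ b :: m3 by rewrite mem_cat inE eqxx orbT.
(* The factor [m] lies between two copies of [a] and contains [b]. If [a] occurs in [m], pass to a
   shorter such factor; otherwise the two copies are successive. *)
move: (m1 ++ _) => m; have [k] := ubnP (size m).
elim: k m u z => // k IHk m u z mk bm Es.
have [am|am] := boolP (a \in m).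
  case/splitPr: am mk bm Es => l1 l2; rewrite size_cat /= mem_cat inE => mk.
  case/or3P => [bl|/eqP -> //|bl] Es; last first.
    apply: (IHk l2 (u ++ a :: l1) z) => //; first by lia.
    by rewrite Es -!catA.
  apply: (IHk l1 u (l2 ++ a :: z)) => //; first by lia.
  by rewrite Es -!catA.
have us : size u < size s by rewrite Es size_cat /=; lia.
have vs : size u + (size m).+1 < size s by rewrite Es !size_cat /= size_cat /=; lia.
have /forallP /(_ (Ordinal vs)) /implyP /= := sS (Ordinal us).
have Eu : nth 0 s (size u) = a by rewrite Es nth_cat ltnn subnn.
have Ev : nth 0 s (size u + (size m).+1) = a.
  rewrite Es nth_cat ltnNge leq_addr /= addKn -[_ :: _]/([:: a] ++ _) /=.
  by rewrite nth_cat ltnn subnn.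
rewrite Eu Ev Es between_cat am eqxx andbT -addn1 leq_add2l.
by move=> /(_ isT) /allP /(_ b bm); apply: ltnW.
Qed.

Lemma stirling_subseq s t : subseq s t -> stirling_word t -> stirling_word s.
Proof.
move=> st /stirling_wordP tS; apply/stirling_wordP => a b abs; apply: tS.
exact: subseq_trans abs st.
Qed.

(** * Insertion of larger letters into a word *)

Definition ins p s w := take p s ++ w ++ drop p s.

Lemma filter_ins c p s w : all (ltn^~ c) s -> all (leq c) w ->
  filter (ltn^~ c) (ins p s w) = s.
Proof.
move=> sc wc; rewrite !filter_cat -[X in _ = X](cat_take_drop p s).
have /all_filterP -> : all (ltn^~ c) (take p s).
  by apply/allP => a /mem_take /(allP sc).
have /all_filterP -> : all (ltn^~ c) (drop p s).
  by apply/allP => a /mem_drop /(allP sc).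
rewrite (eq_in_filter (a2 := pred0)) ?filter_pred0 // => a.
by move/(allP wc) => /= ca; rewrite ltnNge ca.
Qed.

Lemma subseq_filter_imp (P : pred nat) u s :
  all P u -> subseq u s -> subseq u (filter P s).
Proof. by rewrite subseq_filter => -> ->. Qed.

Lemma filter_ins_geq c p s w : all (ltn^~ c) s -> all (leq c) w ->
  filter (leq c) (ins p s w) = w.
Proof.
move=> sc wc; have N v : all (ltn^~ c) v -> filter (leq c) v = [::].
  move=> /allP vc; rewrite (eq_in_filter (a2 := pred0)) ?filter_pred0 // => a.
  by move/vc; rewrite /= ltnNge => /negPf.
rewrite !filter_cat (N (take p s)) ?(N (drop p s)) ?cats0 /=; first exact/all_filterP.
  by apply/allP => a /mem_drop /(allP sc).
by apply/allP => a /mem_take /(allP sc).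
Qed.

Section Insert.
Variables (s w : seq nat) (c p : nat).
Hypotheses (sc : all (ltn^~ c) s) (wc : all (leq c) w) (w0 : w != [::]).
Hypotheses (sS : stirling_word s) (ps : p <= size s).
Let t := ins p s w.

Let stake : all (ltn^~ c) (take p s).
Proof. by apply/allP => a /mem_take /(allP sc). Qed.

Let sdrop : all (ltn^~ c) (drop p s).
Proof. by apply/allP => a /mem_drop /(allP sc). Qed.

(** Together with [filter_ins] this recovers the word and the position, so insertion is
    injective. *)
Lemma find_ins : find (leq c) t = p.
Proof.
rewrite find_cat; have /negPf -> : ~~ has (leq c) (take p s).
  by rewrite -all_predC; apply: sub_all stake => a; rewrite /= -ltnNge.
by rewrite size_takel //; case: (w) w0 wc => //= b v _ /andP [-> _]; rewrite addn0.
Qed.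

(** If [a] and [b] are on the same side of [c], the pattern [a], [b], [a] already lies in [s] or in
    [w]. If [b < c <= a], both copies of [a] lie in the contiguous [w], hence so does [b], which is
    impossible. *)
Lemma stirling_ins : stirling_word w -> stirling_word t.
Proof.
move=> wS; apply/stirling_wordP => a b abt.
have [ac|ca] := ltnP a c; have [bc|cb] := ltnP b c; last 2 first.
- have aN v : all (ltn^~ c) v -> a \notin v.
    by move=> /allP vc; apply/negP => /vc; rewrite /= ltnNge ca.
  have : subseq [:: a; b; a] w.
    rewrite -subseq_rev; apply: (@subseq_cons_catr _ _ (rev (drop p s))).
      by rewrite mem_rev aN.
    rewrite -rev_cat -[_ :: _]/(rev [:: a; b; a]) subseq_rev.
    exact: (subseq_cons_catr (aN _ stake)).
  move/mem_subseq/(_ b); rewrite !inE eqxx orbT => /(_ isT) /(allP wc) /=.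
  by rewrite leqNgt bc.
- have : subseq [:: a; b; a] w.
    by rewrite -(filter_ins_geq p sc wc) subseq_filter_imp //= ca cb.
  by move/(stirling_wordP _ wS).
- have : subseq [:: a; b; a] s.
    by rewrite -(filter_ins p sc wc) subseq_filter_imp //= ac bc.
  by move/(stirling_wordP _ sS).
by move: (leq_trans ac cb) => /ltnW.
Qed.

End Insert.

(* Consecutive ascents for a = a_1 and l = r - 2. That the string contains the
   first occurrence of a + l is automatic in Stirling words (asc_index). *)
Definition asc a l s : bool := has (fun x => infix (x :: iota a l.+1) s) (iota 0 a).

Lemma ascP a l s :
  reflect (exists u x v, s = u ++ x :: iota a l.+1 ++ v /\ x < a) (asc a l s).
Proof.
apply: (iffP hasP) => [[x] | [u [x [v [-> xa]]]]].
  by rewrite mem_iota => /= xa /infixP [u [v ->]]; exists u, x, v.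
exists x; first by rewrite mem_iota.
exact: (infix_infix _ (x :: iota a l.+1)).
Qed.

(* An occurrence of a + l on the left of x would form the pattern
   a + l, x, a + l with x < a + l. *)
Lemma asc_index a l u x v : x < a ->
  stirling_word (u ++ x :: iota a l.+1 ++ v) ->
  index (a + l) (u ++ x :: iota a l.+1 ++ v) = size u + l.+1.
Proof.
move=> xa /stirling_wordP sS.
have alu : a + l \notin u.
  apply/negP => /splitPr us; case: us sS => u1 u2 /(_ (a + l) x).
  have -> : (u1 ++ a + l :: u2) ++ x :: iota a l.+1 ++ v =
     u1 ++ [:: a + l] ++ u2 ++ [:: x] ++ (iota a l.+1 ++ v) by rewrite -!catA.
  suff -> : subseq [:: a + l; x; a + l]
      (u1 ++ [:: a + l] ++ u2 ++ [:: x] ++ (iota a l.+1 ++ v)).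
    by move=> /(_ isT); lia.
  rewrite -[X in subseq X _]/([::] ++ [:: a + l] ++ [::] ++ [:: x] ++ [:: a + l]).
  rewrite !cat_subseq ?sub0seq // sub1seq mem_cat mem_iota; lia.
have -> : iota a l.+1 = iota a l ++ [:: a + l] by rewrite -addn1 iotaD.
rewrite index_cat (negPf alu) -cat1s index_cat inE ifN; last by apply/eqP; lia.
rewrite -catA index_cat mem_iota size_iota /= eqxx addn0.
by rewrite ifN; lia.
Qed.

Lemma filter_all_id (P : pred nat) u : all P u -> filter P u = u.
Proof. by move/all_filterP. Qed.

(** All letters of an ascent string, and the one on its left, are below [c]. Erasing [w] keeps them
    contiguous, so no ascent is created; one is destroyed exactly when [p] is a gap in front of one
    of the [l.+1] letters of its string. *)
Lemma asc_ins s w c p a l : all (ltn^~ c) s -> all (leq c) w -> w != [::] ->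
  stirling_word s -> stirling_word w -> p <= size s -> a + l < c ->
  asc a l (ins p s w) = asc a l s && ~~ (p <= index (a + l) s <= p + l).
Proof.
move=> sc wc w0 sS wS ps alc; apply/idP/andP => [|[/ascP [u [x [v [Es xa]]]]]]; last first.
  have := sS; rewrite {1}Es => /(asc_index xa); rewrite -Es => ->.
  rewrite negb_and -!ltnNge => up; apply/ascP; rewrite /ins Es.
  have [pu|pu] := leqP p (size u).
    exists (take p u ++ w ++ drop p u), x, v; split=> //.
    rewrite takel_cat // drop_cat; case: ifP => [_|pu']; first by rewrite -!catA.
    by have -> : p = size u; [lia | rewrite subnn drop_size drop0 -!catA].
  pose q := p - (size u + l.+2).
  have -> : u ++ x :: iota a l.+1 ++ v = (u ++ x :: iota a l.+1) ++ v by rewrite -catA.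
  have Eq : p = size (u ++ x :: iota a l.+1) + q.
    by rewrite size_cat /= size_iota /q; lia.
  exists u, x, (take q v ++ w ++ drop q v); split=> //.
  rewrite Eq takeD drop_size_cat // take_size_cat // addnC -drop_drop.
  by rewrite drop_size_cat // -!catA.
move=> /ascP [u [x [v [Et xa]]]].
have xc : x < c by lia.
have bc : all (ltn^~ c) (x :: iota a l.+1).
  by apply/allP => b; rewrite inE mem_iota /=; lia.
have Es : s = filter (ltn^~ c) u ++ (x :: iota a l.+1) ++ filter (ltn^~ c) v.
  rewrite -(filter_ins p sc wc) Et -cat_cons !filter_cat.
  by rewrite [filter _ (x :: _)]filter_all_id.
split; first by apply/ascP; exists (filter (ltn^~ c) u), x, (filter (ltn^~ c) v).
have := sS; rewrite Es => /(asc_index xa) ->.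
have nb k : size u <= k < size u + l.+2 -> nth 0 (ins p s w) k < c.
  case/andP=> uk kl; rewrite Et -cat_cons nth_cat.
  rewrite [k < size u]ltnNge uk [nth _ _ _]/= nth_cat ifT; last first.
    by rewrite /= size_iota; lia.
  by apply: (allP bc); rewrite mem_nth //= size_iota; lia.
have nw k : p <= k < p + size w -> c <= nth 0 (ins p s w) k.
  case/andP=> pk kw; rewrite nth_cat size_takel // ltnNge pk /= nth_cat.
  rewrite ifT; last by lia.
  by apply: (allP wc); rewrite mem_nth // ltn_subLR.
have w1 : 0 < size w by case: (w) w0.
(* The string with its left neighbour and the word [w] occupy intervals of positions, with letters
   below [c] and at least [c] respectively; hence one precedes the other. *)
have [] : size u + l.+2 <= p \/ p + size w <= size u.
  have [pu|up] := leqP p (size u).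
    right; rewrite leqNgt; apply/negP => h.
    by have := nb (size u); have := nw (size u); lia.
  left; rewrite leqNgt; apply/negP => h.
  by have := nb p; have := nw p; lia.
- by have := count_size (ltn^~ c) u; rewrite -size_filter; lia.
(* Here [w] lies inside [u], and the [p] letters in front of it survive the filter. *)
move=> pwu; have Eu : u = take (p + size w) (ins p s w) ++ drop (p + size w) u.
  by rewrite Et takel_cat // cat_take_drop.
have : p <= size (filter (ltn^~ c) u).
  rewrite Eu /ins catA take_size_cat; last by rewrite size_cat size_takel.
  rewrite !filter_cat !size_cat [filter _ (take p s)]filter_all_id.
    by rewrite size_takel //; lia.
  by apply/allP => b /mem_take /(allP sc).
by lia.
Qed.

Lemma block_asc r i : 1 < r -> block r i = iota (r.-1 * i.-1 + 1) (r - 2).+1.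
Proof. by move=> r1; rewrite /block; congr iota; lia. Qed.

Lemma block_last r i : 1 < r -> 0 < i -> r.-1 * i.-1 + 1 + (r - 2) = r.-1 * i.
Proof. by case: r i => [|[|r]] [|i] //= _ _; lia. Qed.

Lemma consec_ascE r s i : 1 < r -> 0 < i -> stirling_word s ->
  consec_asc r s i = asc (r.-1 * i.-1 + 1) (r - 2) s.
Proof.
move=> r1 i0 sS; apply/existsP/ascP => [[p] | [u [x [v [Es xa]]]]].
  rewrite block_asc // => /and4P [/prefixP [v dv] _ p0 xa].
  exists (take p.-1 s), (nth 0 s p.-1), v; split=> //.
  rewrite -dv -[LHS](cat_take_drop p.-1) (drop_nth 0) ?prednK //.
  by have := ltn_ord p; lia.
have us : (size u).+1 < size s by rewrite Es size_cat /= size_cat size_iota; lia.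
exists (Ordinal us) => /=.
have := sS; rewrite {1}Es => /(asc_index xa); rewrite -Es block_last // => ->.
rewrite addSnnS eqxx block_asc // Es -cat_rcons drop_size_cat ?size_rcons //.
by rewrite prefix_prefix cat_rcons nth_cat ltnn subnn /= xa.
Qed.

(** * Counting marked Stirling permutations *)

(** Words and marked words form infinite types, so a count is witnessed by a duplicate-free
    enumeration. *)
Definition has_card (T : eqType) (P : pred T) (N : nat) :=
  exists l : seq T, [/\ uniq l, l =i P & size l = N].

Lemma has_card_ext (T : eqType) (P Q : pred T) N :
  P =1 Q -> has_card P N -> has_card Q N.
Proof.
by move=> PQ [l [ul lP sl]]; exists l; split=> // x; rewrite lP; apply: PQ.
Qed.

Lemma has_cardU (T : eqType) (P Q : pred T) M N :
  has_card [pred x | P x && Q x] M -> has_card [pred x | P x && ~~ Q x] N ->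
  has_card P (M + N).
Proof.
move=> [k [uk kP <-]] [l [ul lP <-]]; exists (k ++ l); rewrite size_cat.
split=> // [|x].
  rewrite cat_uniq uk ul andbT /=; apply/hasPn => x.
  rewrite lP => /andP [_ Qx]; change (x \notin k); rewrite kP.
  by apply/negP => /andP [_]; apply/negP.
by rewrite mem_cat kP lP !unfold_in /= -andb_orr orbN andbT.
Qed.

Lemma has_card_map (T U : eqType) (f : T -> U) (P : pred T) (Q : pred U) N :
  {in P &, injective f} -> {in P, forall x, f x \in Q} ->
  (forall y, y \in Q -> exists2 x, x \in P & y = f x) ->
  has_card P N -> has_card Q N.
Proof.
move=> fI fQ Qf [l [ul lP <-]]; exists (map f l); rewrite size_map.
split=> // [|y]; first by rewrite map_inj_in_uniq // => x y; rewrite !lP; apply: fI.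
apply/mapP/idP => [[x]|/Qf [x xP ->]]; first by rewrite lP => /fQ xQ ->.
by exists x; rewrite ?lP.
Qed.

Lemma has_card_sum (T U V : eqType) (f : T -> U -> V) (h : T -> seq U)
    (l : seq T) (Q : pred V) :
  uniq l -> {in l, forall x, uniq (h x)} ->
  (forall x1 x2 y1 y2, x1 \in l -> x2 \in l -> y1 \in h x1 -> y2 \in h x2 ->
     f x1 y1 = f x2 y2 -> x1 = x2 /\ y1 = y2) ->
  (forall z, reflect (exists x y, [/\ x \in l, y \in h x & z = f x y]) (z \in Q)) ->
  has_card Q (\sum_(x <- l) size (h x)).
Proof.
move=> ul uh fI QP; exists [seq f x y | x <- l, y <- h x]; split.
- apply: allpairs_uniq_dep => // -[x1 y1] [x2 y2].
  have memT x y : existT (fun=> U) x y \in [seq existT (fun=> U) x y | x <- l, y <- h x] ->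
      x \in l /\ y \in h x.
    case/allpairsPdep => a [b [al bh E]].
    have -> : x = a := congr1 (fun q : {_ : T & U} => tag q) E.
    by have -> : y = b := congr1 (fun q : {_ : T & U} => tagged q) E.
  move=> /memT [P1 h1] /memT [P2 h2] /= E.
  by have [-> ->] := fI _ _ _ _ P1 P2 h1 h2 E.
- by move=> z; apply/allpairsPdep/QP.
by rewrite size_allpairs_dep sumnE big_map.
Qed.

(** The product rule: every object in [P] has [N] extensions, and the value of [f] determines both
    the object and the extension. *)
Lemma has_card_dep (T U V : eqType) (f : T -> U -> V) (h : T -> seq U)
    (P : pred T) (Q : pred V) M N :
  has_card P M -> {in P, forall x, uniq (h x)} ->
  {in P, forall x, size (h x) = N} ->
  (forall x1 x2 y1 y2, x1 \in P -> x2 \in P -> y1 \in h x1 -> y2 \in h x2 ->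
     f x1 y1 = f x2 y2 -> x1 = x2 /\ y1 = y2) ->
  (forall z, reflect (exists x y, [/\ x \in P, y \in h x & z = f x y]) (z \in Q)) ->
  has_card Q (M * N).
Proof.
move=> [l [ul lP <-]] uh sh fI QP.
have -> : size l * N = \sum_(x <- l) size (h x).
  rewrite (eq_big_seq (fun=> N)) => [|x]; last by rewrite lP; apply: sh.
  by rewrite big_const_seq count_predT iter_addn_0 mulnC.
apply: (has_card_sum (f := f) ul) => [x|x1 x2 y1 y2|z]; rewrite ?lP; first exact: uh.
  exact: fI.
by apply: (iffP (QP z)) => -[x [y]]; exists x, y; [rewrite lP | rewrite -lP].
Qed.

Lemma has_card_uniq (T : eqType) (P : pred T) M N :
  has_card P M -> has_card P N -> M = N.
Proof.
move=> [k [uk kP <-]] [l [ul lP <-]]; apply/perm_size/uniq_perm => // x.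
by rewrite kP lP.
Qed.

Lemma count_interval z K a l : z <= a -> a + l <= z + K ->
  count (fun p => a <= p < a + l) (iota z K) = l.
Proof.
move=> za alK; have -> : K = (a - z) + (l + (z + K - (a + l))) by lia.
rewrite !iotaD !count_cat (_ : z + (a - z) = a); last by lia.
rewrite (eq_in_count (a2 := pred0)) ?count_pred0; last first.
  by move=> p; rewrite mem_iota /=; lia.
rewrite (eq_in_count (a1 := fun p => _) (a2 := predT)); last first.
  by move=> p; rewrite mem_iota /=; lia.
rewrite count_predT size_iota (eq_in_count (a1 := fun p => _) (a2 := pred0)) ?count_pred0.
  by lia.
by move=> p; rewrite mem_iota /=; lia.
Qed.

(** * Dots and the gaps they block *)

Section Marks.
Variable r : nat.
Hypothesis r1 : 1 < r.

Definition mark s i := asc (r.-1 * i.-1 + 1) (r - 2) s.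

(* Inserting larger letters at position p destroys the consecutive ascent i. *)
Definition blocked s p i :=
  p <= index (r.-1 * i) s <= p + (r - 2).

(** The multiset [m] is independent of [n], so that letters of block [n.+1] can be inserted one at a
    time while the dots stay in [[n]]. *)
Definition marked n m d : pred (seq nat * {fset nat}) := [pred q |
  [&& perm_eq q.1 m, stirling_word q.1, (q.2 `<=` [fset i in iota 1 n])%fset,
      #|` q.2|%fset == d & all (mark q.1) q.2]].

(** The value [z = 1] excludes the front gap: a block to be dotted must have a letter on its
    left. *)
Definition gaps z s (D : seq nat) :=
  [seq p <- iota z (size s + 1 - z) | ~~ has (blocked s p) D].

(** The bounds keep all blocked positions between 1 and [size s], so they are counted for [z = 0]
    and [z = 1] alike. By the last clause the letter after a blocked gap lies in block [i], so the
    gap determines the dot. *)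
Lemma mark_nth s i : 0 < i -> stirling_word s -> mark s i ->
  [/\ r.-1 <= index (r.-1 * i) s, index (r.-1 * i) s < size s &
      forall p, blocked s p i -> (nth 0 s p).-1 %/ r.-1 = i.-1].
Proof.
move=> i0 sS /ascP [u [x [v [Es xa]]]].
have := sS; rewrite {1}Es => /(asc_index xa).
rewrite /blocked -Es block_last // => ->; split; first by lia.
  by rewrite Es size_cat /= size_cat size_iota; lia.
move=> p pq; have [k kr ->] : exists2 k, k < r.-1 & p = (size u).+1 + k.
  by exists (p - (size u).+1); lia.
rewrite Es -cat_rcons nth_cat size_rcons ltnNge leq_addr /= addKn.
rewrite -[_ :: _]/(iota (r.-1 * i.-1 + 1) (r - 2).+1 ++ v).
rewrite nth_cat size_iota ifT ?nth_iota; try lia.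
by rewrite addnAC addn1 /= mulnC divnMDl ?divn_small ?addn0; lia.
Qed.

Lemma size_gaps z s D : z <= 1 -> stirling_word s -> uniq D ->
  {in D, forall i, 0 < i} -> all (mark s) D ->
  size (gaps z s D) = size s + 1 - z - r.-1 * size D.
Proof.
move=> z1 sS uD D0 mD.
suff : size (gaps z s D) + r.-1 * size D = size s + 1 - z by lia.
elim: D uD D0 mD => [|i D IHD] /=.
  by rewrite muln0 addn0 /gaps filter_predT size_iota.
case/andP=> iD uD D0 /andP [si sD].
have D0' : {in D, forall j, 0 < j} by move=> j jD; apply: D0; rewrite inE jD orbT.
have i0 : 0 < i by apply: D0; rewrite mem_head.
rewrite -{}IHD // mulnS addnA; congr (_ + _).
have [q0 qs qi] := mark_nth i0 sS si.
have <- : count (blocked s ^~ i) (iota z (size s + 1 - z)) = r.-1.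
  rewrite -[RHS](@count_interval z (size s + 1 - z) (index (r.-1 * i) s - (r - 2))); try lia.
  by apply: eq_count => p; rewrite /blocked; move: (index _ _) q0 => q; lia.
rewrite !size_filter -count_predUI addnC.
rewrite (eq_count (a2 := pred0)) ?count_pred0 => [|p /=]; last first.
  by case: (blocked s p i) => /=; rewrite ?andbF.
apply: eq_count => p /=; rewrite negb_or; case bi : (blocked s p i) => /=; last by rewrite orbF.
apply/esym/negbT/hasPn => j jD; apply/negP => bj.
have [_ _ qj] := mark_nth (D0' _ jD) sS (allP sD _ jD).
(* A gap blocked by both [i] and [j] would precede a letter of both blocks, forcing [i = j]. *)
have := qi p bi; rewrite (qj p bj) => ij; move: iD.
by rewrite (_ : i = j) ?jD //; have := D0' _ jD; lia.
Qed.

Lemma in_marked n m d s (D : {fset nat}) : ((s, D) \in marked n m d) =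
  [&& perm_eq s m, stirling_word s, (D `<=` [fset i in iota 1 n])%fset,
      #|` D|%fset == d & all (mark s) D].
Proof. by []. Qed.

Lemma marked_range n (D : {fset nat}) :
  (D `<=` [fset i in iota 1 n])%fset -> {in D, forall i, 0 < i <= n}.
Proof. by move=> /fsubsetP Dn i /Dn; rewrite !inE /= mem_iota; lia. Qed.

Lemma mark_ins n c s w p i : all (ltn^~ c) s -> all (leq c) w -> w != [::] ->
  stirling_word s -> stirling_word w -> p <= size s -> r.-1 * n < c ->
  0 < i <= n -> mark (ins p s w) i = mark s i && ~~ blocked s p i.
Proof.
move=> sc wc w0 sS wS ps rn /andP [i0 ni]; rewrite /mark (asc_ins sc) // block_last //.
by apply: leq_ltn_trans rn; rewrite leq_mul2l ni orbT.
Qed.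

Lemma all_mark_ins n c s w p D : all (ltn^~ c) s -> all (leq c) w -> w != [::] ->
  stirling_word s -> stirling_word w -> p <= size s -> r.-1 * n < c ->
  {in D, forall i, 0 < i <= n} ->
  all (mark (ins p s w)) D = all (mark s) D && ~~ has (blocked s p) D.
Proof.
move=> sc wc w0 sS wS ps rn Dn; rewrite -all_predC -all_predI.
by apply: eq_in_all => i /Dn iD; rewrite (mark_ins sc wc w0 sS wS ps rn iD).
Qed.

Lemma perm_ins p s w : perm_eq (ins p s w) (s ++ w).
Proof. by rewrite /ins perm_catCA perm_catC cat_take_drop. Qed.

(** The inverse map erases [w]. Since the letters of [w] exceed all letters of the blocks in [[n]],
    only blocked gaps are forbidden, and their number depends only on [d]. The flag [z] excludes the
    front gap. *)
Lemma marked_ins n m d N c w (z : bool) :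
  has_card (marked n m d) N -> all (ltn^~ c) m -> all (leq c) w -> w != [::] ->
  stirling_word w -> r.-1 * n < c ->
  has_card [pred q | [&& marked n (m ++ w) d q, infix w q.1
                       & z ==> ~~ prefix w q.1]]
           (N * (size m + 1 - z - r.-1 * d)).
Proof.
move=> hN mc wc w0 wS rn.
have sc q : q \in marked n m d -> all (ltn^~ c) q.1.
  by case/and5P => qm _ _ _ _; rewrite (perm_all _ qm).
have hz s p D : p \in gaps z s D -> [/\ p <= size s, z <= p & ~~ has (blocked s p) D].
  by rewrite mem_filter mem_iota => /andP [-> ?]; split=> //; lia.
apply: (has_card_dep (f := fun (q : seq nat * {fset nat}) p => (ins p q.1 w, q.2))
                     (h := fun q => gaps z q.1 q.2) hN).
- by move=> q _; rewrite filter_uniq // iota_uniq.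
- move=> q /and5P [qm qS qn qd qD]; rewrite size_gaps ?(perm_size qm) ?leq_b1 //.
    by rewrite (eqP qd).
    exact: fset_uniq.
  by move=> i /(marked_range qn) /andP [].
- move=> [s1 D1] [s2 D2] p1 p2 q1 q2 /hz [ps1 _ _] /hz [ps2 _ _] /= [E ->].
  have := filter_ins p1 (sc _ q1) wc; rewrite E (filter_ins p2 (sc _ q2) wc) => /= ->.
  by rewrite -(find_ins (sc _ q1) wc w0 ps1) E (find_ins (sc _ q2) wc w0 ps2).
move=> [t D]; apply: (iffP idP).
  rewrite inE /= => /and3P [/and5P /= [tm tS Dn Dd tD] /infixP [u [v Et]] zw].
  have Ei : t = ins (size u) (u ++ v) w.
    by rewrite /ins take_size_cat // drop_size_cat.
  have sm : perm_eq (u ++ v) m.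
    by have := tm; rewrite Ei (permPl (perm_ins _ _ _)) perm_cat2r.
  have sS : stirling_word (u ++ v).
    by apply: stirling_subseq tS; rewrite Et cat_subseq // suffix_subseq.
  have sc' : all (ltn^~ c) (u ++ v) by rewrite (perm_all _ sm).
  have us : size u <= size (u ++ v) by rewrite size_cat leq_addr.
  have := tD; rewrite Ei (all_mark_ins sc' wc w0 sS wS us rn (marked_range Dn)).
  case/andP=> sD bD; exists (u ++ v, D), (size u); split=> /=.
  - by rewrite in_marked sm sS Dn Dd.
  - rewrite mem_filter bD mem_iota /=; suff zu : z <= size u.
      by rewrite zu subnKC addn1 ?ltnS // ltnW // ltnS (leq_trans zu).
    case: (z) zw => //=; case: (u) Et => // ->; rewrite ?prefix_prefix //.
  - by rewrite -Ei.
case=> [[s E] [p [sD /hz /= [ps zp bE] [-> ->]]]]; have := sc _ sD; move: sD.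
rewrite in_marked => /and5P [sm sS En Ed sE] /= sc'.
rewrite inE /= /marked /= (all_mark_ins sc' wc w0 sS wS ps rn (marked_range En)).
rewrite sE bE En Ed /= (permPl (perm_ins _ _ _)) perm_cat2r sm.
rewrite (stirling_ins p sc' wc) // infix_infix /=; case: (z) zp => //= p0.
(* At a positive position the result still begins with a letter of [s], which is below [c]. *)
apply/negP => /prefixP [v]; case: (w) w0 wc => // a w' _ /andP [ca _].
case: (p) p0 ps => // k _; case: (s) sc' => //= b s' /andP [bc _] _ [ba].
by move: bc ca; rewrite ba /= ltnNge => /negP.
Qed.

(** * The last block of letters *)

Lemma MseqS n : Mseq r n.+1 =
  Mseq r n ++ iota (r.-1 * n + 1) (r - 2) ++ [:: r.-1 * n.+1; r.-1 * n.+1].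
Proof.
rewrite /Mseq; have -> : r.-1 * n.+1 = r.-1 * n + ((r - 2) + 1) by rewrite mulnS; lia.
rewrite !iotaD !map_cat !flatten_cat /= cats0; congr (_ ++ _).
have -> : 1 + r.-1 * n + (r - 2) = r.-1 * n.+1 by rewrite mulnS; lia.
rewrite dvdn_mulr // [1 + _]addnC; congr (_ ++ _); last first.
  by rewrite (_ : r.-1 * n + _ = r.-1 * n.+1) // mulnS; lia.
rewrite -[RHS]flatten_seq1; congr flatten; apply/eq_in_map => i.
rewrite mem_iota => ir; rewrite ifF //.
(* The offset of [i] in its block lies strictly between 0 and [r.-1], so [i] has multiplicity
   one. *)
have -> : i = r.-1 * n + (i - r.-1 * n) by lia.
by rewrite dvdn_addr ?dvdn_mulr // gtnNdvd //; lia.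
Qed.

Lemma size_Mseq n : size (Mseq r n) = r * n.
Proof.
elim: n => [|n IHn]; first by rewrite /Mseq !muln0.
by rewrite MseqS !size_cat IHn size_iota /= mulnS; lia.
Qed.

Lemma Mseq_lt n c : r.-1 * n < c -> all (ltn^~ c) (Mseq r n).
Proof.
move=> nc; apply/allP => a /flatten_mapP [i]; rewrite mem_iota => ir.
by rewrite mem_nseq => /andP [_ /eqP ->] /=; lia.
Qed.

Lemma ltn_block n : r.-1 * n < r.-1 * n.+1.
Proof. by rewrite mulnS; lia. Qed.

(** A letter [y != e] right after the first [e] would form the pattern [e], [y], [e] with the second
    copy, whence [e <= y <= e]. *)
Lemma max_adjacent t e : stirling_word t -> all (leq^~ e) t ->
  count_mem e t = 2 -> exists u v, t = u ++ [:: e; e] ++ v /\ e \notin u.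
Proof.
move=> /stirling_wordP tS te te2.
have /subseq_consP [u [v [Et _]]] : subseq [:: e] t.
  by rewrite sub1seq -has_pred1 has_count te2.
have : e \in t by rewrite -has_pred1 has_count te2.
move=> et; have := cat_take_drop (index e t) t.
rewrite (drop_nth 0) ?index_mem // nth_index //.
have : e \notin take (index e t) t by rewrite in_take_leq ?index_size ?ltnn.
move: (take _ _) (drop _ _) => {Et}u {}v eu Et.
have := te2; rewrite -Et count_cat (count_memPn eu) add0n /= eqxx => -[ve].
exists u; case: v ve Et => //= y v; case: eqP => [-> _ _|]; first by exists v.
move=> ye; rewrite !add0n => ve Et; exfalso.
have /tS : subseq [:: e; y; e] t.
  rewrite -Et -[X in subseq X _]cat0s cat_subseq ?sub0seq //= !eqxx.
  by rewrite sub1seq -has_pred1 has_count ve.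
have := allP te y; rewrite -Et mem_cat !inE eqxx !orbT => /(_ isT) /= h1 h2.
by apply: ye; apply/eqP; rewrite eqn_leq h1.
Qed.

Lemma top_count n t : perm_eq t (Mseq r n.+1) ->
  all (leq^~ (r.-1 * n.+1)) t /\ count_mem (r.-1 * n.+1) t = 2.
Proof.
move=> tM; rewrite (perm_all _ tM) (seq.permP tM); split.
  by apply: (Mseq_lt (c := (r.-1 * n.+1).+1)).
have nM := Mseq_lt (ltn_block n).
rewrite MseqS !count_cat (count_memPn _) ?add0n; last first.
  by apply/negP => /(allP nM) /=; rewrite ltnn.
rewrite (count_memPn _) /= ?eqxx // mem_iota; apply/negP.
by rewrite mulnS; lia.
Qed.

Definition topblock n := iota (r.-1 * n + 1) r.-1 ++ [:: r.-1 * n.+1].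

Lemma topblockE n :
  topblock n = iota (r.-1 * n + 1) (r - 2) ++ [:: r.-1 * n.+1; r.-1 * n.+1].
Proof.
have -> : topblock n = iota (r.-1 * n + 1) (r - 2 + 1) ++ [:: r.-1 * n.+1].
  by rewrite /topblock; congr (iota _ _ ++ _); lia.
by rewrite iotaD -catA /=; congr (_ ++ _ :: _); rewrite mulnS; lia.
Qed.

Lemma perm_topblock n : Mseq r n.+1 = Mseq r n ++ topblock n.
Proof. by rewrite MseqS topblockE. Qed.

(** The two copies of the largest letter are adjacent, so the second copy directly follows the
    ascent string and completes [topblock n]. Conversely, a letter in front of that factor comes
    from [Mseq r n] and is therefore smaller. *)
Lemma mark_top n t : stirling_word t -> perm_eq t (Mseq r n.+1) ->
  mark t n.+1 = infix (topblock n) t && ~~ prefix (topblock n) t.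
Proof.
move=> tS tM; have [te t2] := top_count tM.
have al : r.-1 * n + 1 + (r - 2) = r.-1 * n.+1 by rewrite mulnS; lia.
have is_ : iota (r.-1 * n + 1) (r - 2).+1 =
    iota (r.-1 * n + 1) (r - 2) ++ [:: r.-1 * n.+1].
  by rewrite -[(r - 2).+1]addn1 iotaD al.
have [u' [v' [Et eu]]] := max_adjacent tS te t2.
have it : index (r.-1 * n.+1) t = size u'.
  by rewrite Et index_cat (negPf eu) /= eqxx addn0.
rewrite /mark [n.+1.-1]/=; apply/ascP/andP => [[u [x [v [Eu xa]]]]|[/infixP [u [v Eu]] np]].
  have := tS; rewrite {1}Eu => /(asc_index xa); rewrite -Eu al it => su.
  have Ev : v = r.-1 * n.+1 :: v'.
    have : (u ++ x :: iota (r.-1 * n + 1) (r - 2)) ++ r.-1 * n.+1 :: v =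
           u' ++ r.-1 * n.+1 :: r.-1 * n.+1 :: v'.
      by rewrite -[RHS]Et Eu is_ -!catA.
    move/eqP; rewrite eqseq_cat; first by case/andP=> _ /eqP [].
    by rewrite size_cat /= size_iota su; lia.
  split.
    apply/infixP; exists (rcons u x), v'.
    by rewrite topblockE Eu Ev is_ cat_rcons -!catA.
  (* A prefix would put the first copy of the largest letter at position [r - 2], but at least
     [r.-1] letters precede it. *)
  apply/negP => /prefixP [w Ew].
  have : index (r.-1 * n.+1) t = r - 2.
    rewrite Ew topblockE -catA index_cat mem_iota ifF ?size_iota /= ?eqxx ?addn0 //.
    by rewrite mulnS; lia.
  by rewrite it su; lia.
case/lastP: u Eu => [Eu|u x Eu]; first by move: np; rewrite Eu prefix_prefix.
exists u, x, (r.-1 * n.+1 :: v); split.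
  by rewrite Eu topblockE is_ cat_rcons -!catA.
have : x \in Mseq r n.
  have : perm_eq (rcons u x ++ v) (Mseq r n).
    rewrite -(perm_cat2r (topblock n)) -perm_topblock -(permPr tM) Eu.
    by rewrite -catA perm_cat2l perm_catC.
  by move/perm_mem <-; rewrite mem_cat mem_rcons mem_head.
have /allP nM : all (ltn^~ (r.-1 * n + 1)) (Mseq r n) by apply: Mseq_lt; rewrite addn1.
exact: nM.
Qed.

(** * The recurrence for marked Stirling permutations *)

Lemma stirling_const a n : stirling_word (nseq n a).
Proof.
apply/stirling_wordP => b c /mem_subseq bcs.
have := bcs b; have := bcs c; rewrite !inE !eqxx ?orbT !mem_nseq.
by move=> /(_ isT) /andP [_ /eqP ->] /(_ isT) /andP [_ /eqP ->].
Qed.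

(** After [i] insertions there are [r * n + i + 1] gaps, of which [r.-1 * d] are blocked. The
    choices for [i < j] multiply to the falling factorial. *)
Lemma marked_singles n d N j : d <= n -> j <= r - 2 ->
  has_card (marked n (Mseq r n) d) N ->
  has_card (marked n (Mseq r n ++ iota (r.-1 * n + 1) j) d)
           (N * (r * n - r.-1 * d + j) ^_ j).
Proof.
move=> dn + hN; elim: j => [|j IHj] jr; first by rewrite cats0 muln1.
have iS : iota (r.-1 * n + 1) j.+1 = iota (r.-1 * n + 1) j ++ [:: r.-1 * n + 1 + j].
  by rewrite -[j.+1]addn1 iotaD.
rewrite {}iS catA.
(* This makes the truncated difference exact. *)
have le_dn : r.-1 * d <= r * n by apply: leq_mul => //; apply: leq_pred.
have nc : all (ltn^~ (r.-1 * n + 1 + j)) (Mseq r n ++ iota (r.-1 * n + 1) j).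
  rewrite all_cat Mseq_lt ?addn1; last by lia.
  by apply/allP => a; rewrite mem_iota /=; lia.
have := marked_ins (w := [:: r.-1 * n + 1 + j]) false (IHj (ltnW jr)) nc.
rewrite /= leqnn => /(_ isT isT (stirling_const _ 1)) H.
have {}H := H ltac:(lia).
rewrite [_ + j.+1]addnS ffactSS mulnCA [_.+1 * _]mulnC.
have -> : (r * n - r.-1 * d + j).+1 =
    size (Mseq r n ++ iota (r.-1 * n + 1) j) + 1 - 0 - r.-1 * d.
  by rewrite size_cat size_Mseq size_iota; lia.
apply: has_card_ext H => -[s D] /=.
rewrite andbT; apply: andb_idr => /and5P /= [sm _ _ _ _].
by rewrite infix1s (perm_mem sm) mem_cat inE eqxx orbT.
Qed.

(** After the [r - 2] single letters, the adjacent pair of largest letters goes in as one word and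
    contributes the top factor of the falling factorial. *)
Lemma marked_pair n d N : d <= n ->
  has_card (marked n (Mseq r n) d) N ->
  has_card (marked n (Mseq r n.+1) d) (N * (r * n - r.-1 * d + r.-1) ^_ r.-1).
Proof.
move=> dn hN; have le_dn : r.-1 * d <= r * n by apply: leq_mul => //; apply: leq_pred.
have nc : all (ltn^~ (r.-1 * n.+1)) (Mseq r n ++ iota (r.-1 * n + 1) (r - 2)).
  rewrite all_cat Mseq_lt ?ltn_block //.
  by apply/allP => a; rewrite mem_iota /= mulnS; lia.
have := marked_ins (w := nseq 2 (r.-1 * n.+1)) false (marked_singles dn (leqnn _) hN) nc.
rewrite /= leqnn => /(_ isT isT (stirling_const _ 2) (ltn_block n)) H.
have -> : (r * n - r.-1 * d + r.-1) ^_ r.-1 =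
    (r * n - r.-1 * d + (r - 2)).+1 * (r * n - r.-1 * d + (r - 2)) ^_ (r - 2).
  by rewrite -ffactSS -addnS; congr ((_ + _) ^_ _); lia.
rewrite mulnCA [_.+1 * _]mulnC.
have -> : (r * n - r.-1 * d + (r - 2)).+1 =
    size (Mseq r n ++ iota (r.-1 * n + 1) (r - 2)) + 1 - 0 - r.-1 * d.
  by rewrite size_cat size_Mseq size_iota; lia.
apply: has_card_ext H => -[s D]; rewrite -catA -MseqS /=.
rewrite andbT; apply: andb_idr => /and5P /= [sm sS _ _ _].
have [se s2] := top_count sm.
by have [u [v [-> _]]] := max_adjacent sS se s2; apply: infix_infix.
Qed.

Lemma fsub_iotaS n (D : {fset nat}) : n.+1 \notin D ->
  (D `<=` [fset i in iota 1 n.+1])%fset = (D `<=` [fset i in iota 1 n])%fset.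
Proof.
move=> nD; apply/fsubsetP/fsubsetP => Dn i iD; have := Dn i iD.
  rewrite !inE /= !mem_iota; have : i != n.+1 by apply: contraNneq nD => <-.
  by lia.
by rewrite !inE /= !mem_iota; lia.
Qed.

Lemma stirling_uniq s : uniq s -> stirling_word s.
Proof.
move=> us; apply/stirling_wordP => a b /subseq_uniq /(_ us).
by rewrite /= !inE eqxx orbT.
Qed.

Lemma stirling_topblock n : stirling_word (topblock n).
Proof.
rewrite topblockE; set s := iota _ _; set w := [:: _; _].
have -> : s ++ w = ins (size s) s w by rewrite /ins take_size drop_size cats0.
apply: (@stirling_ins _ _ (r.-1 * n.+1)); rewrite /= ?leqnn //.
- by apply/allP => a; rewrite mem_iota /= mulnS; lia.
- exact: stirling_uniq (iota_uniq _ _).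
exact: (stirling_const _ 2).
Qed.

(** By [mark_top], a dot on [n.+1] means that [topblock n] was inserted as a whole, away from the
    front: of [r * n] such gaps, [r.-1 * d] are blocked. *)
Lemma marked_block n d N : d <= n ->
  has_card (marked n (Mseq r n) d) N ->
  has_card [pred q | marked n.+1 (Mseq r n.+1) d.+1 q && (n.+1 \in q.2)]
           (N * (r * n - r.-1 * d)).
Proof.
move=> dn hN.
have nc : all (ltn^~ (r.-1 * n + 1)) (Mseq r n) by apply: Mseq_lt; rewrite addn1.
have wc : all (leq (r.-1 * n + 1)) (topblock n).
  rewrite all_cat /= mulnS; apply/andP; split; last by lia.
  by apply/allP => a; rewrite mem_iota; case/andP.
have w0 : topblock n != [::] by rewrite -size_eq0 size_cat /= addn1.
have rn : r.-1 * n < r.-1 * n + 1 by rewrite addn1.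
have := marked_ins true hN nc wc w0 (stirling_topblock n) rn.
rewrite size_Mseq addnK -perm_topblock => {hN}.
apply: (has_card_map (f := fun q : seq nat * {fset nat} => (q.1, (n.+1 |` q.2)%fset))).
- move=> [s D] [t E] /= /and3P [/and5P [_ _ /= Dn _ _] _ _].
  move=> /and3P [/and5P [_ _ /= En _ _] _ _] [-> DE].
  have nD : n.+1 \notin D by apply/negP => /(marked_range Dn); rewrite ltnn andbF.
  have nE : n.+1 \notin E by apply/negP => /(marked_range En); rewrite ltnn andbF.
  by rewrite -(fsetU1K nD) DE fsetU1K.
- move=> [s D] /and3P [/and5P [/= sM sS Dn Dd sD] sw pw].
  have nD : n.+1 \notin D by apply/negP => /(marked_range Dn); rewrite ltnn andbF.
  have nDn : (n.+1 |` D `<=` [fset i in iota 1 n.+1])%fset.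
    by rewrite fsubUset fsub1set fsub_iotaS // Dn andbT !inE /= ?mem_iota; lia.
  rewrite inE /= fset1U1 andbT /marked /= sM sS nDn cardfsU1 nD (eqP Dd) eqxx /=.
  apply/allP => i; rewrite !inE => /predU1P [->|/(allP sD) //].
  by rewrite mark_top // sw pw.
move=> [s E] /andP [/and5P [/= sM sS En Ed sE] nE].
exists (s, (E `\ n.+1)%fset) => /=; last by rewrite fsetD1K.
have tw : mark s n.+1 := allP sE _ nE.
rewrite mark_top // in tw; case/andP: tw => sw pw.
rewrite !inE /marked /= sM sS sw pw /= andbT.
have nD : n.+1 \notin (E `\ n.+1)%fset by rewrite !inE eqxx.
rewrite -fsub_iotaS // (fsubset_trans (fsubD1set _ _)) //=.
have := cardfsD1 n.+1 E; rewrite nE (eqP Ed) add1n => -[<-]; rewrite eqxx /=.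
by apply/allP => i; rewrite !inE => /andP [_ /(allP sE)].
Qed.

Lemma marked_unmarked_top n d N : has_card (marked n (Mseq r n.+1) d) N ->
  has_card [pred q | marked n.+1 (Mseq r n.+1) d q && (n.+1 \notin q.2)] N.
Proof.
apply: has_card_ext => -[s D] /=; rewrite andbC; case: (boolP (n.+1 \in D)) => nD /=.
  apply/negbTE/negP => /and5P [_ _ Dn _ _].
  by have := marked_range Dn nD; rewrite ltnn andbF.
by rewrite /marked /= fsub_iotaS ?andbT.
Qed.

Lemma marked_none n m d : n < d -> has_card (marked n m d) 0.
Proof.
move=> nd; exists [::]; split=> // -[s D]; rewrite in_nil; apply/esym/negbTE/negP.
case/and5P => _ _ /= /fsubset_leq_card + /eqP Dd _.
rewrite Dd card_fseq undup_id ?iota_uniq //.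
by rewrite size_iota leqNgt nd.
Qed.

Lemma cycle_rec_gt n k : n < k -> cycle_rec r n k = 0.
Proof.
elim: n k => [|n IHn] [|k] //= nk.
by rewrite !IHn ?muln0 //; lia.
Qed.

(** Put [k = n.+1 - d]. Words with [n.+1] dotted give the first term of the recurrence and the
    others the second, by [r * n - r.-1 * d = n + r.-1 * (n - d)]. *)
Lemma has_card_marked n d : d <= n ->
  has_card (marked n (Mseq r n) d) (cycle_rec r n (n - d)).
Proof.
elim: n d => [|n IHn] d.
  rewrite leqn0 => /eqP ->; exists [:: ([::], fset0)]; split=> // -[s D].
  rewrite !inE /= /Mseq muln0 /=; apply/eqP/and5P => [[-> ->]|].
    by split=> //; apply/stirling_wordP.
  by case=> /perm_nilP -> _ _; rewrite cardfs_eq0 => /eqP -> _.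
move=> dn; have hin : has_card
    [pred q | marked n.+1 (Mseq r n.+1) d q && (n.+1 \in q.2)]
    ((n + r.-1 * (n.+1 - d)) * cycle_rec r n (n.+1 - d)).
  (* Without dots [k = n.+1] exceeds [n], and the first term vanishes. *)
  case: d dn => [_|d dn].
    rewrite cycle_rec_gt // muln0; exists [::]; split=> // -[s D]; rewrite in_nil.
    apply/esym/negbTE/negP => /andP [/and5P [_ _ _ /=]].
    by rewrite cardfs_eq0 => /eqP -> _; rewrite inE.
  rewrite subSS mulnC (_ : n + _ = r * n - r.-1 * d); last first.
    have -> : r * n = n + r.-1 * n by rewrite -mulSn prednK //; lia.
    by rewrite mulnBr addnBA // leq_mul2l -ltnS dn orbT.
  exact: marked_block (IHn d dn).
(* At [d = n.+1], where [k = 0], the count is 0: either the factor [n] or [cycle_rec r n 0]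
   vanishes. *)
have [dn'|nd] := leqP d n; last first.
  have -> : cycle_rec r n.+1 (n.+1 - d) =
      (n + r.-1 * (n.+1 - d)) * cycle_rec r n (n.+1 - d) + 0.
    have -> : n.+1 - d = 0 by lia.
    by case: (n) => [|k]; rewrite /= ?muln0.
  exact: has_cardU hin (marked_unmarked_top (marked_none _ nd)).
move: hin; rewrite subSn //= => hin; apply: has_cardU hin _.
apply: marked_unmarked_top; rewrite mulnC.
have -> : n + r.-1 * (n - d).+1 = r * n - r.-1 * d + r.-1.
  have -> : r * n = n + r.-1 * n by rewrite -mulSn prednK //; lia.
  by rewrite mulnS mulnBr -addnBA ?leq_mul2l ?dn' ?orbT //; lia.
exact: marked_pair dn' (IHn d dn').
Qed.

Lemma has_card_fset (K : choiceType) (A : {fset K}) :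
  has_card [pred x | x \in A] #|` A|%fset.
Proof. by exists (enum_fset A); rewrite fset_uniq. Qed.

Lemma fsub_CAsc n s (D : {fset nat}) : stirling_word s ->
  (D `<=` CAsc r n s)%fset = (D `<=` [fset i in iota 1 n])%fset && all (mark s) D.
Proof.
move=> sS; have H i : (i \in CAsc r n s) = (i \in iota 1 n) && mark s i.
  rewrite !inE /=; apply: andb_id2l; rewrite mem_iota => /andP [i0 _].
  exact: consec_ascE.
apply/fsubsetP/andP => [sD|[/fsubsetP Dn /allP sD] i iD].
  split; last by apply/allP => i /sD; rewrite H => /andP [].
  by apply/fsubsetP => i /sD; rewrite H !inE => /andP [].
by rewrite H sD // andbT; have := Dn i iD; rewrite !inE.
Qed.

Lemma card_marked n d : d <= n ->
  #|` marked_stirling_perms r n d|%fset = cycle_rec r n (n - d).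
Proof.
move=> dn; apply: has_card_uniq (has_card_fset _) _.
apply: has_card_ext (has_card_marked dn) => -[s D].
rewrite -[RHS]/((s, D) \in marked_stirling_perms r n d) in_marked_stirling_perms.
rewrite in_stirling_perms /marked /= -andbA; apply: andb_id2l => _.
by apply: andb_id2l => sS; rewrite fsub_CAsc // -andbA [_ && all _ _]andbC.
Qed.
End Marks.

(** * From dots to numbers of consecutive ascents *)

Lemma card_fset_draws (K : choiceType) (A : {fset K}) d :
  #|` [fset B in fpowerset A | #|` B| == d]|%fset = 'C(#|` A|%fset, d).
Proof.
apply: has_card_uniq (has_card_fset _) _.
have : has_card (mem [set B : {set A} | #|B| == d]) 'C(#|` A|%fset, d).
  exists (enum [set B : {set A} | #|B| == d]); rewrite enum_uniq -cardE card_draws cardfE.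
  by split=> // B; rewrite mem_enum.
have fK (B : {set A}) : #|` [fsetval x in B]|%fset = #|B|.
  by rewrite -(card_fsub (fset_sub_val _ _)) FSetK.
apply: (has_card_map (f := fun B : {set A} => [fsetval x in B]%fset)).
- by move=> B C _ _; apply: (can_inj (@FSetK _ A)).
- move=> B; rewrite !inE => Bd.
  by rewrite fpowersetE fset_sub_val fK.
move=> B; rewrite !inE /= fpowersetE => /andP [BA Bd]; exists (fsub A B).
  by rewrite !inE card_fsub.
by rewrite fsubK.
Qed.

Lemma card_marked_sum r n d :
  #|` marked_stirling_perms r n d|%fset =
  \sum_(s <- stirling_perms r n) 'C(#|` CAsc r n s|%fset, d).
Proof.
apply: has_card_uniq (has_card_fset _) _.
under eq_bigr do rewrite -card_fset_draws.
apply: (has_card_sum (f := pair)) => [|s _|s1 s2 D1 D2 _ _ _ _ [-> ->] //|[s D]].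
- exact: fset_uniq.
- exact: fset_uniq.
rewrite inE /= in_marked_stirling_perms; apply: (iffP and3P) => [[sS DC Dd]|].
  by exists s, D; split=> //; rewrite !inE /= fpowersetE DC Dd.
case=> t [E [tS ED [-> ->]]].
have /andP [EC Ed] : (E `<=` CAsc r n t)%fset && (#|` E|%fset == d).
  by move: ED; rewrite !inE /= fpowersetE.
by split.
Qed.

Lemma card_CAsc r n s : #|` CAsc r n s|%fset <= n.
Proof.
have {2}<- : #|` [fset i in iota 1 n]|%fset = n.
  by rewrite card_fseq undup_id ?iota_uniq ?size_iota.
by apply/fsubset_leq_card/fsubsetP => i; rewrite !inE => /andP [].
Qed.

Lemma card_casc r n l : #|` stirling_perms_casc r n l|%fset =
  count (fun s => #|` CAsc r n s|%fset == l) (stirling_perms r n).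
Proof.
rewrite -size_filter; apply/perm_size/uniq_perm; rewrite ?filter_uniq ?fset_uniq //.
by move=> s; rewrite mem_filter !inE andbC.
Qed.

(** Each word admits any [d]-subset of its consecutive ascents as dots; grouping words by their
    number of ascents, at most [n], gives an entry of the product of S and B. *)
Lemma card_marked_casc r n d :
  #|` marked_stirling_perms r n d|%fset =
  \sum_(l < n.+1) #|` stirling_perms_casc r n l|%fset * 'C(l, d).
Proof.
rewrite card_marked_sum.
under [RHS]eq_bigr do rewrite card_casc -sum1_count big_distrl /= big_mkcond /=.
rewrite exchange_big; apply: eq_bigr => s _.
rewrite (bigD1 (Ordinal (card_CAsc r n s : _ < n.+1))) //= eqxx mul1n big1 ?addn0 //.
by move=> i; rewrite -val_eqE /= eq_sym => /negPf ->.
Qed.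

Theorem proposition5p2 (r : nat) (hr : (2 <= r)%N) :
  (forall n k : nat,
     quasi_eulerian_cycle r n k = Posz (#|` stirling_perms_casc r n k|)%fset) /\
  (forall n k : nat, (k <= n)%N ->
     stirling_cycle r n k = (#|` marked_stirling_perms r n (n - k)|)%fset).
Proof.
have H n k : k <= n ->
    stirling_cycle r n k = (#|` marked_stirling_perms r n (n - k)|)%fset.
  by move=> kn; rewrite stirling_cycleE // card_marked ?leq_subr // subKn.
split=> // n k; pose S l : int := Posz #|` stirling_perms_casc r n l|%fset.
(* Column [j] counts marked words with [n - (n - j) = j] dots, so this is row [n] of S B. *)
have cC j : j <= n -> checkC r n j = (\sum_(l < n.+1) S l * binmx l j)%R.
  move=> jn; rewrite /checkC jn H ?leq_subr // subKn // card_marked_casc.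
  rewrite (big_morph Posz PoszD (erefl _)); apply: eq_bigr => l _.
  by rewrite PoszM /binmx natz.
rewrite /quasi_eulerian_cycle /ltmul.
have qE (j : 'I_n.+1) :
    (checkC r n j * ltinv binmx j k = \sum_(l < n.+1) S l * (binmx l j * binmxV j k))%R.
  rewrite (ltinv_unique binmx_lt binmx_mulV) (cC j (ltn_ord j)) big_distrl /=.
  by apply: eq_bigr => l _; rewrite mulrA.
rewrite (eq_bigr _ (fun j _ => qE j)) exchange_big /=.
have E (l : 'I_n.+1) :
    (\sum_(j < n.+1) S l * (binmx l j * binmxV j k) = S l * infmx1 l k)%R.
  rewrite -binmx_mulV /ltmul big_distrr /=.
  (* Row [l] of B vanishes beyond column [l <= n], so summing up to [n] gives the entry of B times
     its inverse. *)
  rewrite (big_ord_widen n.+1 (fun j => S l * (binmx l j * binmxV j k))%R (ltn_ord l)).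
  rewrite [RHS]big_mkcond; apply: eq_bigr => j _.
  by rewrite ltnS; case: leqP => // lj; rewrite binmx_lt // mul0r mulr0.
rewrite (eq_bigr _ (fun l _ => E l)).
have [kn|nk] := ltnP k n.+1.
  rewrite (bigD1 (Ordinal kn)) //= /infmx1 eqxx mulr1 big1 ?addr0 // => l.
  by rewrite -val_eqE /= => /negPf ->; rewrite mulr0.
(* For [k > n] both sides are 0, as no word has more than [n] consecutive ascents. *)
rewrite big1 => [|l _]; last first.
  by rewrite /infmx1 (ltn_eqF (leq_trans (ltn_ord l) nk)) mulr0.
congr Posz; apply/esym; rewrite card_casc; apply/eqP; rewrite -leqn0 leqNgt -has_count.
apply/hasPn => s _; apply: contraTneq nk => <-.
by rewrite -leqNgt card_CAsc.
Qed.
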